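(* The smallest fertility number that is congruent to $3$ modulo $4$ is $27$.
   Context: A permutation is a permutation of a finite set of positive integers, written as a word in one-line notation (a word with distinct entries). $S_n$ denotes the set of permutations of $\{1,\ldots,n\}$. West's stack-sorting map $s$ is defined recursively: $s$ sends the empty permutation to the empty permutation, and if $\pi$ is a nonempty permutation with largest entry $m$, write $\pi=LmR$, where $L$ and $R$ are the (possibly empty) substrings of $\pi$ to the left and right of $m$; then $s(\pi)=s(L)s(R)m$. The fertility of a permutation $\pi$ is $|s^{-1}(\pi)|$, the number of preimages of $\pi$ under $s$. A nonnegative integer $f$ is a fertility number if there exists a permutation with fertility $f$. *)

(* Defs.v *)
From mathcomp Require Import all_boot.
From mathcomp Require Import classical_sets functions cardinality.
Set Implicit Arguments. Unset Strict Implicit. Unset Printing Implicit Defensive.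
Local Open Scope classical_set_scope.
Local Open Scope card_scope.

Definition is_permutation (w : seq nat) : bool := uniq w && all (leq 1) w.

Definition largest (w : seq nat) : nat := foldr maxn 0 w.

(* The fuel [n] bounds the recursion depth; [size w] is always enough, see
   [stack_sort_split], which is West's recursion s(LmR) = s(L)s(R)m. *)
Fixpoint stack_sort_rec (n : nat) (w : seq nat) : seq nat :=
  if n is n'.+1 then
    if w is [::] then [::]
    else
      let m := largest w in
      let i := index m w in
      stack_sort_rec n' (take i w) ++ stack_sort_rec n' (drop i.+1 w) ++ [:: m]
  else [::].

Definition stack_sort (w : seq nat) : seq nat := stack_sort_rec (size w) w.

Definition preimages (p : seq nat) : set (seq nat) :=
  [set w | is_permutation w /\ stack_sort w = p].

Definition has_fertility (p : seq nat) (f : nat) : Prop :=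
  preimages p #= `I_f.

Definition fertility_number (f : nat) : Prop :=
  exists p : seq nat, is_permutation p /\ has_fertility p f.

Lemma mem_largest (w : seq nat) : w != [::] -> largest w \in w.
Proof.
elim: w => // x w IH _; rewrite /largest /= inE -/(largest w).
case: (eqVneq w [::]) => [->|/IH H]; first by rewrite /= maxn0 eqxx.
by case: leqP => _; rewrite ?eqxx ?H ?orbT.
Qed.

Lemma largest_split (L R : seq nat) (m : nat) :
  all (fun x => x < m) (L ++ R) -> largest (L ++ m :: R) = m.
Proof.
rewrite all_cat => /andP[HL HR].
have HR' : largest R <= m.
  elim: R HR => //= x R IH /andP[/ltnW xm /IH H].
  by rewrite geq_max xm.
elim: L HL => [_|x L IH /=/andP[/ltnW xm /IH ->]].
  by rewrite /largest /=; apply/maxn_idPl.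
exact/maxn_idPr.
Qed.

Lemma stack_sort_rec_fuel (n : nat) (w : seq nat) :
  size w <= n -> stack_sort_rec n w = stack_sort w.
Proof.
suff H : forall k n w, size w <= k -> size w <= n ->
    stack_sort_rec n w = stack_sort_rec k w.
  by move=> Hn; apply: H.
elim=> [|k IH] [|{}n] [|x {}w] // Hk Hn.
rewrite /stack_sort_rec -/stack_sort_rec.
set m := largest _; set i := index _ _.
have Hi : i < size (x :: w) by rewrite index_mem mem_largest.
have Ht : size (take i (x :: w)) <= size w by rewrite size_take Hi -ltnS.
have Hd : size (drop i.+1 (x :: w)) <= size w by rewrite size_drop /= subSS leq_subr.
by rewrite (IH n (take _ _)) ?(IH n (drop _ _)) //;
  [exact: leq_trans Hd Hk | exact: leq_trans Hd Hn
  | exact: leq_trans Ht Hk | exact: leq_trans Ht Hn].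
Qed.

Lemma stack_sort_split (L R : seq nat) (m : nat) :
  all (fun x => x < m) (L ++ R) ->
  stack_sort (L ++ m :: R) = stack_sort L ++ stack_sort R ++ [:: m].
Proof.
move=> H; have mL : m \notin L.
  apply/negP=> mL; move/allP: H => /(_ m).
  by rewrite mem_cat mL ltnn => /(_ isT).
rewrite {1}/stack_sort size_cat /= addnS /= largest_split //.
rewrite index_cat (negbTE mL) /= eqxx addn0 take_size_cat // -cat_rcons.
rewrite drop_size_cat ?size_rcons // !stack_sort_rec_fuel ?leq_addr ?leq_addl //.
by case: L {H mL}.
Qed.

(* Main.v *)
Require Import Defs.
From mathcomp Require Import all_boot zify.
From mathcomp Require Import classical_sets functions cardinality.

(** A preimage of [p] under the stack-sorting map is the in-order reading of a
decreasing binary tree whose postorder reading is [p].  Read [p] from left to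
right and keep a stack of finished subtrees: each entry takes its 0, 1 or 2
children from the top of the stack and is then pushed itself.  The heights of
the stack form a path from 0 to 1 with steps 1, 0 and -1.  A path arises from a
tree exactly when it is [admissible]: as long as the entries after the [i]-th
one are smaller than it, none of them can be an ancestor of it, so the stack has
to stay strictly higher than it was just after entry [i].  A level step is an
entry with a single child, which may hang on the left or on the right, so a path
with [k] level steps arises from [2 ^ k] trees ([count_height_list]), and the
fertility of [p] is the sum of these powers over all admissible paths
([size_preimage_list]).

Let this sum be 3 modulo 4.  The number of level steps has the parity of
[size p + 1] on every path, so modulo 4 the sum counts the zigzags, the paths
without level steps, and there are at least three of them ([three_zigzags]).
Other admissible paths are built from zigzags in two ways.  Admissibility only
bounds differences of heights, hence it is kept by the rounded average of two
paths ([admissible_average]).  And if a step goes up without being forced to,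
then the path can be lowered by 1 between this step and the down step that
matches it, which turns both steps into level ones ([lowering]).

If some zigzag has two free up steps, then lowering it at the one, at the other,
and at both gives paths of weights 4, 4 and 16, and the sum is at least
3 + 24 = 27 ([two_free_ups]).  Otherwise each of three zigzags is determined by
the place [l1 < l2 < l3] of its only free up step.  Let [u] be the place of the
down step that matches [l3] in the third zigzag.  Averaging and lowering show
that each of the six pairs of places among [l1, l2, l3, u] is the pair of level
steps of an admissible path, and the sum is at least 3 + 6 * 4 = 27
([three_single_free_ups]).  The permutation 3214567 attains the bound. *)

Set Implicit Arguments. Unset Strict Implicit. Unset Printing Implicit Defensive.

(** * Admissible height paths *)

(** [D i j] is meant to say that entry [j] is too small to have entry [i] below
it in the tree; entry 0 is the bottom of the stack, and the hypothesis
[forall r, D 0 r] of later lemmas then keeps the stack nonempty. *)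
Definition admissible (n : nat) (D : rel nat) (H : nat -> nat) : Prop :=
  [/\ H 0 = 0, H n = (0 < n),
      forall t, t < n -> H t <= (H t.+1).+1 /\ H t.+1 <= (H t).+1
    & forall p s, p < s <= n -> (forall r, p < r <= s -> D p r) -> H p < H s].

Definition levels (n : nat) (H : nat -> nat) : seq nat :=
  [seq t <- iota 0 n | H t.+1 == H t].

Lemma mem_levels n H (t : nat) : (t \in levels n H) = (t < n) && (H t.+1 == H t).
Proof. by rewrite mem_filter mem_iota add0n andbC. Qed.

Lemma eq_levels n H H' : (forall t, t <= n -> H t = H' t) -> levels n H = levels n H'.
Proof.
move=> e; apply: eq_in_filter => t; rewrite mem_iota add0n /= => tn.
by rewrite !e // ltnW.
Qed.

Lemma eq_admissible n (D : rel nat) H H' : (forall t, t <= n -> H t = H' t) ->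
  admissible n D H -> admissible n D H'.
Proof.
move=> e [H0 Hn st dom]; split.
- by rewrite -e.
- by rewrite -e.
- by move=> t tn; rewrite -!e //; [apply: st | lia].
- by move=> p s ps Dps; rewrite -!e; [apply: dom | lia | lia].
Qed.

Lemma eq_admissible_rel n (D D' : rel nat) H :
  (forall i j, i < j <= n -> D i j = D' i j) ->
  admissible n D H -> admissible n D' H.
Proof.
move=> e [H0 Hn st dom]; split=> // p s ps Dps; apply: dom => // r rr.
by rewrite e ?Dps; lia.
Qed.

Lemma admissible_gt0 n (D : rel nat) H t : (forall r, D 0 r) -> admissible n D H ->
  0 < t <= n -> 0 < H t.
Proof. by move=> D0 [H0 _ _ dom] tn; rewrite -{1}H0; apply: dom. Qed.

(** Every step that is not level changes the parity of the height. *)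
Lemma odd_height n (D : rel nat) H : admissible n D H ->
  odd (H n) = odd (n + size (levels n H)).
Proof.
case=> H0 _ st _; suff: forall t, t <= n -> odd (H t) = odd (t + size (levels t H)) by exact.
elim=> [|t IH] tn; first by rewrite H0.
have := IH (ltnW tn); have := st t tn.
rewrite /levels -[in iota 0 t.+1]addn1 iotaD filter_cat size_cat /= add0n.
case: eqP => [->|ne] /= step; rewrite ?addn1 ?addn0 ?addnS /= ?negbK => <- //.
by case: (ltngtP (H t.+1) (H t)) ne => // lt _; [have -> : H t = (H t.+1).+1 by lia
  | have -> : H t.+1 = (H t).+1 by lia]; rewrite /= ?negbK.
Qed.

Definition average (H H' : nat -> nat) (t : nat) : nat := (H t + H' t)./2.

(** All conditions bound a difference [H s - H t] from one side by an integer.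
The bounds for the two paths add up to an even bound for the difference of the
sums, and an even bound survives halving with rounding down. *)
Lemma admissible_average n (D : rel nat) H H' : admissible n D H -> admissible n D H' ->
  admissible n D (average H H').
Proof.
move=> [H0 Hn st dom] [H0' Hn' st' dom']; rewrite /average; split.
- by rewrite H0 H0'.
- by rewrite Hn Hn'; lia.
- by move=> t tn; have := st t tn; have := st' t tn; lia.
- by move=> p s ps Dps; have := dom p s ps Dps; have := dom' p s ps Dps; lia.
Qed.

(** The step from [t] to [t.+1] has to go up when [D t t.+1] holds; the free up
steps are the other ones. *)
Definition free_up (n : nat) (D : rel nat) (H : nat -> nat) : seq nat :=
  [seq t <- iota 0 n | ~~ D t t.+1 & H t.+1 == (H t).+1].

Lemma mem_free_up n (D : rel nat) H (t : nat) :
  (t \in free_up n D H) = [&& t < n, ~~ D t t.+1 & H t.+1 == (H t).+1].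
Proof. by rewrite mem_filter mem_iota add0n andbC. Qed.

Definition lowered (H : nat -> nat) (l u t : nat) : nat := H t - (l < t <= u).

(** The down step [u] that matches [l] is the first return to the height [H l].
A condition that could break compares a height inside the lowered stretch with
one at [p <= l]; there [p = l] is excluded because the step [l] is free, and for
[p < l] the unlowered height at [l] already lies above [H p]. *)
Lemma lowering n (D : rel nat) H (l : nat) : (forall r, D 0 r) -> admissible n D H ->
  l \in free_up n D H ->
  exists u, [/\ l < u < n, H u = (H u.+1).+1,
                forall t, l < t <= u -> H l < H t
              & admissible n D (lowered H l u)].
Proof.
move=> D0 adm; rewrite mem_free_up => /and3P[ln Dl /eqP Hl].
have [H0 Hn st dom] := adm.
have l0 : 0 < l by case: (posnP l) Dl => // ->; rewrite D0.
have Hl0 : 0 < H l by apply: (admissible_gt0 D0 adm); lia.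
have lnp : l < n.-1.
  have [e|] := eqVneq n l.+1; last by lia.
  by move: Hl; rewrite -e Hn; lia.
(* The path ends at height 1 and [H l] is positive, so it returns to [H l]. *)
have ex : exists u, (l < u) && (H u.+1 <= H l).
  by exists n.-1; rewrite lnp prednK ?Hn; lia.
case: (ex_minnP ex) => u /andP[lu Hu] umin.
have above t : l < t <= u -> H l < H t.
  case: t => // t /andP[lt tu]; case: (ltngtP l t) => [lt'||<-]; [|lia|lia].
  by rewrite ltnNge; apply/negP => Ht; have := umin t; rewrite lt' Ht; lia.
have un : u < n.
  have [// | nu] := ltnP u n.
  have := umin n.-1; rewrite prednK; last lia.
  rewrite Hn => um; have : u <= n.-1 by apply: um; rewrite lnp; lia.
  by lia.
have Hlu := above u; have Hstu := st u un.
exists u; split=> //; [lia | lia |].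
rewrite /lowered; split.
- by rewrite H0.
- by rewrite Hn; lia.
- move=> t tn; have := st t tn; have := above t; have := above t.+1.
  case: (ltngtP t l) => [||e]; case: (ltngtP t u) => [||e'];
    rewrite ?e ?e'; lia.
move=> p s /andP[ps sn] Dps; have Hps := dom p s; rewrite ps sn in Hps.
have {}Hps : H p < H s by exact: Hps.
have [/andP[ls su]|] := boolP (l < s <= u); last by lia.
have [lp|pl] := ltnP l p; first by have := above p; lia.
have pnl : p != l by apply: contra Dl => /eqP <-; apply: Dps; lia.
have: H p < H l by apply: dom; [lia | move=> r rr; apply: Dps; lia].
by have := above s; lia.
Qed.

Lemma lowered_levels n H (l u : nat) : l < u < n -> H l.+1 = (H l).+1 ->
  H u = (H u.+1).+1 -> (forall t, l < t <= u -> H l < H t) ->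
  levels n (lowered H l u) =i [predU [:: l; u] & levels n H].
Proof.
move=> lun Hl Hu above t; rewrite !inE !mem_levels /lowered.
have := above t; have := above t.+1.
case: (ltngtP t l) => [||e]; case: (ltngtP t u) => [||e'];
  rewrite ?e ?e'; lia.
Qed.

(** * Weights of paths and the bound 27 *)

(** Paths are stored as lists without their initial height 0. *)
Definition height (h : seq nat) (t : nat) : nat := nth 0 (0 :: h) t.

Definition level_steps (h : seq nat) : seq nat := levels (size h) (height h).

(** The number of trees with height path [h]: a left or a right child for each
level step. *)
Definition weight (h : seq nat) : nat := 2 ^ size (level_steps h).

Definition path_of (n : nat) (H : nat -> nat) : seq nat := mkseq (fun t => H t.+1) n.

Lemma height_path_of n H t : H 0 = 0 -> t <= n -> height (path_of n H) t = H t.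
Proof. by case: t => [->|t] //= _ tn; rewrite /height /= nth_mkseq. Qed.

Lemma level_steps_path_of n H : H 0 = 0 -> level_steps (path_of n H) = levels n H.
Proof.
move=> H0; rewrite /level_steps size_mkseq; apply: eq_levels => t.
exact: height_path_of.
Qed.

Lemma eq_heights n h h' : size h = n -> size h' = n ->
  (forall t, t <= n -> height h t = height h' t) -> h = h'.
Proof.
move=> sh sh' e; apply: (@eq_from_nth _ 0); first by rewrite sh sh'.
by move=> i; rewrite sh => /e.
Qed.

Definition enumerates_paths (n : nat) (D : rel nat) (S : seq (seq nat)) : Prop :=
  uniq S /\ forall h, h \in S <-> size h = n /\ admissible n D (height h).

Lemma path_of_mem n (D : rel nat) S H : enumerates_paths n D S ->
  admissible n D H -> path_of n H \in S.
Proof.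
move=> [_ memS] adm; apply/memS; rewrite size_mkseq; split=> //.
have [H0 _ _ _] := adm; apply: eq_admissible adm => t tn.
by rewrite height_path_of.
Qed.

Definition zigzags (S : seq (seq nat)) : seq (seq nat) :=
  [seq h <- S | level_steps h == [::]].

Lemma weight_sum_ge (S s : seq (seq nat)) : uniq S -> {subset s <= S} ->
  uniq ([::] :: map level_steps s) ->
  size (zigzags S) + \sum_(h <- s) weight h <= \sum_(h <- S) weight h.
Proof.
move=> uS sS /= /andP[nlev ulev].
have -> : size (zigzags S) = \sum_(h <- S | level_steps h == [::]) weight h.
  rewrite -sum1_size big_filter; apply: eq_bigr => h /eqP.
  by rewrite /weight => ->.
rewrite [in leqRHS](bigID (fun h => level_steps h == [::])) /= leq_add2l.
have -> : \sum_(h <- s) weight h = \sum_(h <- s | level_steps h != [::]) weight h.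
  rewrite big_seq_cond [RHS]big_seq_cond; apply: eq_bigl => h.
  rewrite andbT; case hs: (h \in s) => //=; apply/esym/eqP => h0.
  by move: nlev; rewrite -h0 map_f.
by apply: uniq_sub_le_big (map_uniq ulev) uS sS => // x y; exact: leq_addr.
Qed.

Lemma weight_mod4 h : size (level_steps h) != 1 ->
  weight h = (level_steps h == [::]) %[mod 4].
Proof.
rewrite /weight; case: (level_steps h) => [|x [|y s]] //= _.
by rewrite !expnS mulnA modnMr.
Qed.

(** If the sum is odd then some weight is odd, so some path has no level step;
by parity no path has exactly one, and all weights but those of zigzags vanish
modulo 4. *)
Lemma three_zigzags n (D : rel nat) S : enumerates_paths n D S ->
  \sum_(h <- S) weight h = 3 %[mod 4] -> 3 <= size (zigzags S).
Proof.
move=> [uS memS] f3.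
have parity h : h \in S -> odd (0 < n) = odd (n + size (level_steps h)).
  by move=> /memS[sh adm]; rewrite /level_steps sh -(odd_height adm); case: adm => _ ->.
have [n_even|n_odd] := boolP (~~ odd n && (0 < n)).
  suff: ~~ odd (\sum_(h <- S) weight h).
    have : odd ((\sum_(h <- S) weight h) %% 4) = odd (3 %% 4) by rewrite f3.
    by rewrite odd_mod // => ->.
  rewrite big_seq_cond; elim/big_rec: _ => // h x /andP[hS _] ox.
  rewrite oddD (negbTE ox) addbF /weight oddX /= orbF.
  have := parity _ hS; move: n_even => /andP[/negbTE ne ->].
  by rewrite oddD ne; case: (size _).
have: \sum_(h <- S) weight h = size (zigzags S) %[mod 4].
  have -> : size (zigzags S) = \sum_(h <- S) (level_steps h == [::]).
    by rewrite size_filter -sum1_count big_mkcond; apply: eq_bigr => h _; case: eqP.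
  rewrite big_seq [in RHS]big_seq.
  apply: (big_ind2 (fun x y => x = y %[mod 4])) => // [x x' y y' e e'|h hS].
    by rewrite -modnDm e e' modnDm.
  rewrite weight_mod4 //.
  have := parity _ hS; move: n_odd; rewrite oddD.
  by case: (posnP n) => [->|_] /=; [|rewrite andbT negbK => ->];
    case: (size _) => [|[]].
rewrite f3; case: (size _) => [|[|[|k]]] //.
Qed.

(** Lowering at one free up step leaves the others free, so it can be repeated. *)
Lemma lowered_path n (D : rel nat) H (l : nat) : (forall r, D 0 r) ->
  admissible n D H -> l \in free_up n D H ->
  exists H', [/\ admissible n D H',
    size (levels n H') = (size (levels n H)).+2,
    l \in levels n H', {subset levels n H <= levels n H'}
  & forall t, t \in free_up n D H -> t != l ->
      t \in free_up n D H' /\ t \notin levels n H'].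
Proof.
move=> D0 adm lfree; have [u [lun Hu above adm']] := lowering D0 adm lfree.
move: lfree; rewrite mem_free_up => /and3P[ln Dl /eqP Hl].
have levE := lowered_levels lun Hl Hu above.
exists (lowered H l u); split=> //.
- rewrite -[RHS]/(size [:: l, u & levels n H]); apply: perm_size.
  apply: uniq_perm => [||t]; first exact: filter_uniq (iota_uniq _ _).
    rewrite /= !inE !mem_levels filter_uniq ?iota_uniq //; lia.
  by rewrite levE !inE orbA.
- by rewrite levE !inE eqxx.
- by move=> t tlev; rewrite levE !inE tlev orbT.
move=> t; rewrite !mem_free_up => /and3P[tn -> /eqP Ht] tl.
rewrite levE !inE mem_levels /lowered.
have := above t; have := above t.+1.
by case: (ltngtP t l) tl => // ? _; case: (ltngtP t u) => [||e']; rewrite ?e' in Ht *; lia.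
Qed.

Lemma two_free_ups n (D : rel nat) S h (a b : nat) : (forall r, D 0 r) ->
  enumerates_paths n D S -> 3 <= size (zigzags S) -> h \in zigzags S ->
  a \in free_up n D (height h) -> b \in free_up n D (height h) -> a != b ->
  27 <= \sum_(h <- S) weight h.
Proof.
move=> D0 enumS F3; rewrite mem_filter => /andP[/eqP hlev hS] afree bfree ab.
have [uS memS] := enumS; have /memS[sh adm] := hS.
rewrite /level_steps sh in hlev.
have [Ha [adma sza aHa _ Hafree]] := lowered_path D0 adm afree.
have [Hb [admb szb bHb _ Hbfree]] := lowered_path D0 adm bfree.
have [bHa bnHa] : b \in free_up n D Ha /\ b \notin levels n Ha.
  by apply: Hafree; rewrite // eq_sym.
have [_ anHb] := Hbfree a afree ab.
have [Hab [admab szab _ _ _]] := lowered_path D0 adma bHa.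
rewrite hlev /= in sza szb; rewrite sza in szab.
have lev H : admissible n D H -> level_steps (path_of n H) = levels n H.
  by case=> H0 _ _ _; exact: level_steps_path_of.
have := @weight_sum_ge S [:: path_of n Ha; path_of n Hb; path_of n Hab] uS.
rewrite !big_cons big_nil /weight [map _ _]/= (lev _ adma) (lev _ admb) (lev _ admab).
rewrite sza szb szab.
move=> bound; apply: leq_trans (bound _ _); first exact: (leq_add F3 (leqnn 24)).
  by move=> x; rewrite !inE => /or3P[] /eqP ->; exact: path_of_mem enumS _.
have neq s t : size s != size t -> (s == t :> seq nat) = false.
  by move=> st; apply/eqP => e; rewrite e eqxx in st.
have ne : (levels n Ha == levels n Hb) = false.
  by apply/eqP => e; rewrite -e aHa in anHb.
by rewrite /= !inE ne !neq ?sza ?szb ?szab.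
Qed.

Definition forced_ups (D : rel nat) (t : nat) : nat :=
  count (fun s => D s s.+1) (iota 0 t).

(** Up to time [t] a zigzag has gone up (H t + t) / 2 times; an up step is either
forced or free. *)
Lemma zigzag_height n (D : rel nat) H : admissible n D H -> levels n H = [::] ->
  forall t, t <= n ->
  H t + t = 2 * (forced_ups D t + count (fun s => s < t) (free_up n D H)).
Proof.
move=> [H0 _ st dom] nolev.
have freeE t : t <= n ->
    count (fun s => s < t) (free_up n D H) = size (free_up t D H).
  move=> tn; rewrite -size_filter /free_up -filter_predI.
  rewrite (eq_filter (_ : predI _ _ =1 predI [pred s | ~~ D s s.+1 & H s.+1 == (H s).+1]
    (fun s => s < t))); last by move=> s /=; rewrite andbC.
  by rewrite filter_predI (@filter_iota_ltn 0).
move=> t tn; rewrite freeE //; elim: t tn => [|t IH] tn; first by rewrite H0.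
have {IH} := IH (ltnW tn); have := st t tn; have := mem_levels n H t.
rewrite nolev tn /= in_nil => /esym/eqP Ht.
rewrite /free_up /forced_ups -[in iota 0 t.+1]addn1 iotaD count_cat filter_cat.
rewrite size_cat /= add0n.
have : D t t.+1 -> H t < H t.+1.
  move=> Dt; apply: dom; first lia.
  by move=> r rr; have -> : r = t.+1 by lia.
have [->|/eqP ne] := eqVneq (H t.+1) (H t).+1.
  by case: (D _ _) => /=; lia.
by case: (D _ _) => /= [/(_ isT)|_] /=; lia.
Qed.

(** Heights of a path that takes all forced up steps, is level at [x] and [y], and
goes down otherwise.  Compared with a down step, a level step counts once and an
up step twice, so [x = y] describes a zigzag whose only free up step is [x]. *)
Definition two_bends n (D : rel nat) (x y : nat) (H : nat -> nat) : Prop :=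
  forall t, t <= n -> H t + t = 2 * forced_ups D t + (x < t) + (y < t).

Lemma two_bends_levels n (D : rel nat) x y H : two_bends n D x y H ->
  x < y < n -> ~~ D x x.+1 -> ~~ D y y.+1 -> levels n H = [:: x; y].
Proof.
move=> bends xyn Dx Dy; apply: (irr_sorted_eq ltn_trans ltnn).
- by apply: sorted_filter; [exact: ltn_trans | exact: iota_ltn_sorted].
- by rewrite /= andbT; case/andP: xyn.
move=> t; rewrite mem_levels !inE; have [tn|nt] := ltnP t n; last lia.
have := bends t (ltnW tn); have := bends t.+1 tn.
rewrite /forced_ups -[in iota 0 t.+1]addn1 iotaD count_cat /= add0n addn0.
have [->|tx] := eqVneq t x; first by rewrite (negbTE Dx); lia.
have [->|ty] := eqVneq t y; first by rewrite (negbTE Dy); lia.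
by case: (D _ _); lia.
Qed.

(** In the coordinates of [two_bends], averaging the zigzag [(x, x)] with a path
[(y, y')], where [y <= y'], and rounding down gives [(x, y')]; lowering the
zigzag [(l3, l3)] gives [(l3, u)]. *)
Lemma three_single_free_ups n (D : rel nat) S h1 h2 h3 (l1 l2 l3 : nat) :
  (forall r, D 0 r) -> enumerates_paths n D S -> 3 <= size (zigzags S) ->
  [/\ h1 \in zigzags S, h2 \in zigzags S & h3 \in zigzags S] ->
  [/\ free_up n D (height h1) = [:: l1], free_up n D (height h2) = [:: l2]
    & free_up n D (height h3) = [:: l3]] ->
  l1 < l2 < l3 -> 27 <= \sum_(h <- S) weight h.
Proof.
move=> D0 enumS F3 [z1 z2 z3] [f1 f2 f3] /andP[l12 l23].
have l13 := ltn_trans l12 l23.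
have [uS memS] := enumS.
have zig h l : h \in zigzags S -> free_up n D (height h) = [:: l] ->
    [/\ admissible n D (height h), l < n, ~~ D l l.+1 & two_bends n D l l (height h)].
  rewrite mem_filter => /andP[/eqP lev /memS[sh adm]] fr.
  rewrite /level_steps sh in lev.
  have : l \in free_up n D (height h) by rewrite fr inE.
  rewrite mem_free_up => /and3P[ln Dl _]; split=> // t tn.
  by rewrite (zigzag_height adm lev tn) fr /=; lia.
have [a1 n1 D1 b1] := zig _ _ z1 f1; have [a2 n2 D2 b2] := zig _ _ z2 f2.
have [a3 n3 D3 b3] := zig _ _ z3 f3.
have [|u [lun Hu above a3']] := @lowering n D (height h3) l3 D0 a3.
  by rewrite f3 inE.
have Du : ~~ D u u.+1.
  apply/negP => Du; have [_ _ _ dom] := a3.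
  suff : height h3 u < height h3 u.+1 by lia.
  apply: dom; first lia.
  by move=> r rr; have -> : r = u.+1 by lia.
have b3' : two_bends n D l3 u (lowered (height h3) l3 u).
  by move=> t tn; have := b3 t tn; have := above t; rewrite /lowered; lia.
have bends_avg x y y' H H' : two_bends n D x x H -> two_bends n D y y' H' ->
    y <= y' -> two_bends n D x y' (average H H').
  by move=> b b' yy' t tn; have := b t tn; have := b' t tn; rewrite /average; lia.
have [l3u un] := andP lun.
have fits x y H : two_bends n D x y H -> x < y -> y < n -> ~~ D x x.+1 ->
    ~~ D y y.+1 -> admissible n D H -> exists2 h, h \in S & level_steps h = [:: x; y].
  move=> b xy yn Dx Dy adm; exists (path_of n H); first exact: path_of_mem enumS adm.
  rewrite level_steps_path_of; last by case: adm.
  by apply: (two_bends_levels b) => //; rewrite xy yn.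
have [h12 S12 e12] := fits _ _ _ (bends_avg _ _ _ _ _ b1 b2 (leqnn _)) l12 n2 D1 D2
  (admissible_average a1 a2).
have [h13 S13 e13] := fits _ _ _ (bends_avg _ _ _ _ _ b1 b3 (leqnn _)) l13 n3 D1 D3
  (admissible_average a1 a3).
have [h23 S23 e23] := fits _ _ _ (bends_avg _ _ _ _ _ b2 b3 (leqnn _)) l23 n3 D2 D3
  (admissible_average a2 a3).
have [h3u S3u e3u] := fits _ _ _ b3' l3u un D3 Du a3'.
have [h1u S1u e1u] := fits _ _ _ (bends_avg _ _ _ _ _ b1 b3' (ltnW l3u))
  (ltn_trans l13 l3u) un D1 Du (admissible_average a1 a3').
have [h2u S2u e2u] := fits _ _ _ (bends_avg _ _ _ _ _ b2 b3' (ltnW l3u))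
  (ltn_trans l23 l3u) un D2 Du (admissible_average a2 a3').
have := @weight_sum_ge S [:: h12; h13; h23; h3u; h1u; h2u] uS.
rewrite !big_cons big_nil /weight [map _ _]/= e12 e13 e23 e3u e1u e2u.
move=> bound; apply: leq_trans (bound _ _); first exact: (leq_add F3 (leqnn 24)).
  by apply/allP; rewrite /= S12 S13 S23 S3u S1u S2u.
have neq x y : x < y -> ((x == y) = false) * ((y == x) = false).
  by move=> xy; rewrite ltn_eqF // gtn_eqF.
have l2u := ltn_trans l23 l3u.
by rewrite /= !inE /= !eqseq_cons !(neq l1 l2, neq l1 l3, neq l2 l3, neq l1 u, neq l2 u, neq l3 u)
  ?eqxx ?andbF //; apply: ltn_trans l12 _.
Qed.

(** All zigzags end at the same height, so they have the same number of free up
steps, and this number is positive when there are two different zigzags. *)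
Lemma weight_sum_ge27 n (D : rel nat) S : (forall r, D 0 r) ->
  enumerates_paths n D S -> \sum_(h <- S) weight h = 3 %[mod 4] ->
  27 <= \sum_(h <- S) weight h.
Proof.
move=> D0 enumS f3; have F3 := three_zigzags enumS f3.
have [uS memS] := enumS.
have uZ : uniq (zigzags S) by exact: filter_uniq.
have [/hasP[h hZ]|/hasPn lone] :=
  boolP (has (fun h => 1 < size (free_up n D (height h))) (zigzags S)).
  case E: (free_up _ _ _) => [|a [|b s]] // _.
  have ab : a != b.
    have : uniq (free_up n D (height h)) by exact: filter_uniq (iota_uniq _ _).
    by rewrite E /= inE negb_or -andbA => /andP[].
  by apply: (two_free_ups D0 enumS F3 hZ _ _ ab); rewrite E !inE eqxx ?orbT.
have info h : h \in zigzags S ->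
    [/\ size h = n, height h n = (0 < n) & forall t, t <= n -> height h t + t =
          2 * (forced_ups D t + count (fun s => s < t) (free_up n D (height h)))].
  rewrite mem_filter => /andP[/eqP lev /memS[sh adm]].
  rewrite /level_steps sh in lev; split=> //; first by case: adm.
  exact: zigzag_height adm lev.
have inj h h' : h \in zigzags S -> h' \in zigzags S ->
    free_up n D (height h) = free_up n D (height h') -> h = h'.
  move=> /info[sh _ fh] /info[sh' _ fh'] e; apply: (eq_heights sh sh') => t tn.
  by apply/eqP; rewrite -(eqn_add2r t) fh // fh' // e.
have sz h : h \in zigzags S ->
    2 * (forced_ups D n + size (free_up n D (height h))) = (0 < n) + n.
  move=> /info[_ <- fh]; rewrite fh //; congr (2 * (_ + _)).
  apply/esym/eqP; rewrite -all_count; apply/allP => t.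
  by rewrite mem_free_up => /andP[].
case Z: (zigzags S) F3 uZ => [|h1 [|h2 [|h3 s]]] // _.
have z1 : h1 \in zigzags S by rewrite Z !inE eqxx ?orbT.
have z2 : h2 \in zigzags S by rewrite Z !inE eqxx ?orbT.
have z3 : h3 \in zigzags S by rewrite Z !inE eqxx ?orbT.
rewrite /= !inE !negb_or => /and3P[/and3P[n12 n13 _] /andP[n23 _] _].
have F3 : 3 <= size (zigzags S) by rewrite Z.
have frees h h' : h \in zigzags S -> h' \in zigzags S -> h != h' ->
   exists l l', [/\ free_up n D (height h) = [:: l],
                    free_up n D (height h') = [:: l'] & l != l'].
  move=> hZ hZ' ne; have := lone _ hZ.
  have : size (free_up n D (height h)) = size (free_up n D (height h')).
    by have := etrans (sz _ hZ) (esym (sz _ hZ')) => /eqP; rewrite eqn_pmul2l // eqn_add2l => /eqP.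
  case E: (free_up n D (height h)) => [|l [|? ?]] //;
    case E': (free_up n D (height h')) => [|l' [|? ?]] // _ _.
    by rewrite (inj _ _ hZ hZ') ?E ?E' ?eqxx in ne.
  exists l, l'; split=> //; apply: contra ne => /eqP ll'.
  by rewrite (inj _ _ hZ hZ') // E E' ll'.
have [l1 [l2 [f1 f2 l12]]] := frees _ _ z1 z2 n12.
have [l1' [l3 [f1' f3' l13]]] := frees _ _ z1 z3 n13.
have [l2' [l3' [f2' f3'' l23]]] := frees _ _ z2 z3 n23.
have ? : l1' = l1 by case: (etrans (esym f1') f1).
have ? : l2' = l2 by case: (etrans (esym f2') f2).
have ? : l3' = l3 by case: (etrans (esym f3'') f3').
subst l1' l2' l3'.
have sorted_case := three_single_free_ups D0 enumS F3.
case: (ltngtP l1 l2) l12 => // l12 _; case: (ltngtP l1 l3) l13 => // l13 _;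
  case: (ltngtP l2 l3) l23 => // l23 _.
- by apply: (sorted_case h1 h2 h3 l1 l2 l3); rewrite ?l12.
- by apply: (sorted_case h1 h3 h2 l1 l3 l2); rewrite ?l13.
- by have := ltn_trans (ltn_trans l12 l23) l13; rewrite ltnn.
- by apply: (sorted_case h3 h1 h2 l3 l1 l2); rewrite ?l13.
- by apply: (sorted_case h2 h1 h3 l2 l1 l3); rewrite ?l12.
- by have := ltn_trans (ltn_trans l12 l13) l23; rewrite ltnn.
- by apply: (sorted_case h2 h3 h1 l2 l3 l1); rewrite ?l23.
by apply: (sorted_case h3 h2 h1 l3 l2 l1); rewrite ?l23.
Qed.

(** * Cutting a path in two *)

(** The relation [D] on the entries after the [k]-th one, with the bottom of the
stack put back as entry 0. *)
Definition after (k : nat) (D : rel nat) : rel nat :=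
  fun i j => (i == 0) || D (k + i) (k + j).

(** If the last entry has [n1] entries in its left and [n2] in its right subtree,
then the right subtree is built on top of the finished left one, if there is one,
and both are on the stack just before the last entry. *)
Definition cut (n1 n2 : nat) (H : nat -> nat) : bool :=
  [&& H n1 == (0 < n1), all (fun t => (0 < n1) < H (n1 + t)) (iota 1 n2)
    & H (n1 + n2) == (0 < n1) + (0 < n2)].

Lemma cutP n1 n2 (H : nat -> nat) :
  reflect [/\ H n1 = (0 < n1), forall t, 0 < t <= n2 -> (0 < n1) < H (n1 + t)
            & H (n1 + n2) = (0 < n1) + (0 < n2)] (cut n1 n2 H).
Proof.
apply: (iffP and3P) => -[c1 c2 c3]; split.
- exact/eqP.
- by move=> t tn; apply: (allP c2); rewrite mem_iota add1n ltnS.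
- exact/eqP.
- exact/eqP.
- by apply/allP => t; rewrite mem_iota add1n ltnS; exact: c2.
exact/eqP.
Qed.

Definition second_part (k : nat) (H : nat -> nat) (t : nat) : nat := H (k + t) - (0 < k).

Lemma admissible_split n1 n2 (D : rel nat) H :
  admissible (n1 + n2).+1 D H -> cut n1 n2 H ->
  admissible n1 D H /\ admissible n2 (after n1 D) (second_part n1 H).
Proof.
move=> [H0 Hn st dom] /cutP[c1 c2 c3]; split; split=> //.
- by move=> t tn; apply: st; lia.
- by move=> p s ps; apply: dom; lia.
- by rewrite /second_part addn0 c1 subnn.
- by rewrite /second_part c3 addKn.
- move=> t tn; rewrite /second_part addnS; have := st (n1 + t); lia.
move=> p s /andP[ps sn] Dps; have := c2 s; rewrite /second_part.
have [->|p0] := posnP p; first by rewrite addn0 c1; lia.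
have : H (n1 + p) < H (n1 + s).
  apply: dom; first lia; move=> r rr; have := Dps (r - n1).
  rewrite /after eqn0Ngt p0 /= subnKC; last lia.
  by apply; lia.
by lia.
Qed.

(** The last entry is larger than all others, so the last height is subject to the
conditions from entry 0 alone.  A condition between the two parts is
implied by the conditions at the end of the first part, which has height 1. *)
Lemma admissible_join n1 n2 (D : rel nat) H H' : (forall r, D 0 r) ->
  (forall i, 0 < i <= n1 + n2 -> ~~ D i (n1 + n2).+1) ->
  admissible n1 D H -> admissible n2 (after n1 D) H' ->
  (forall t, t <= n2 -> H (n1 + t) = H' t + (0 < n1)) -> H (n1 + n2).+1 = 1 ->
  admissible (n1 + n2).+1 D H /\ cut n1 n2 H.
Proof.
move=> D0 Dn [H0 Hn1 st1 dom1] adm2 HH' Hn.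
have pos2 t : 0 < t <= n2 -> 0 < H' t.
  by apply: admissible_gt0 adm2 => r.
have [H'0 H'n st2 dom2] := adm2.
have HE t : n1 <= t <= n1 + n2 -> H t = H' (t - n1) + (0 < n1).
  by move=> tn; rewrite -HH'; [congr H; lia | lia].
have HN : H (n1 + n2) = (0 < n2) + (0 < n1) by rewrite HE ?leq_addr ?leqnn // addKn H'n.
split; last first.
  apply/cutP; split=> //; last by rewrite HN addnC.
  by move=> t tn; rewrite HH'; [have := pos2 t; lia | lia].
split=> //.
- move=> t; rewrite ltnS => tn; have [tn1|n1t] := ltnP t n1; first exact: st1.
  have [{}tn|nt] := ltnP t (n1 + n2).
    by have := st2 (t - n1); rewrite !HE ?subSn //; lia.
  have -> : t = n1 + n2 by lia.
  by rewrite Hn HN; lia.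
move=> p s /andP[ps sn] Dps.
have sN : s < (n1 + n2).+1 \/ p = 0 /\ s = (n1 + n2).+1.
  have [/eqP e|] := boolP (s == (n1 + n2).+1); last by lia.
  right; split=> //; apply/eqP; rewrite eqn0Ngt; apply/negP => p0.
  have := Dn p; rewrite -e Dps; [|lia]; move=> /(_ _); rewrite p0 /=; lia.
case: sN => [sN|[-> ->]]; last by rewrite H0 Hn.
have [sn1|n1s] := leqP s n1; first by apply: dom1 => //; lia.
have Hs : H s = H' (s - n1) + (0 < n1) by apply: HE; lia.
have := pos2 (s - n1).
have [pn1|n1p] := ltnP p n1.
  have : H p < H n1 by apply: dom1; [lia | move=> r rr; apply: Dps; lia].
  by rewrite Hn1; lia.
have Hp : H p = H' (p - n1) + (0 < n1) by apply: HE; lia.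
have [e|ne] := eqVneq p n1.
  by rewrite Hp e subnn H'0; lia.
have : H' (p - n1) < H' (s - n1).
  apply: dom2; first lia; move=> r rr; rewrite /after subnKC //.
  by rewrite Dps ?orbT //; lia.
by lia.
Qed.

Lemma size_levels_cut n1 n2 (H : nat -> nat) : cut n1 n2 H -> H (n1 + n2).+1 = 1 ->
  size (levels (n1 + n2).+1 H) =
  (H (n1 + n2) == 1) + size (levels n1 H) + size (levels n2 (second_part n1 H)).
Proof.
move=> /cutP[c1 c2 c3] Hn.
rewrite /levels -[in LHS]addn1 !iotaD !filter_cat !size_cat /= add0n Hn.
have -> : iota n1 n2 = map (addn n1) (iota 0 n2) by rewrite -iotaDl addn0.
rewrite filter_map size_map.
have -> : [seq t <- iota 0 n2 | preim (addn n1) (fun t => H t.+1 == H t) t] =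
          [seq t <- iota 0 n2 | second_part n1 H t.+1 == second_part n1 H t].
  apply: eq_in_filter => t; rewrite mem_iota add0n /= /second_part -addnS => tn.
  have := c2 t; have := c2 t.+1; case: t tn => [|t] tn; last by lia.
  by rewrite addn0 c1; lia.
by rewrite eq_sym; case: eqP => _ /=; lia.
Qed.

(** An only child, that is [H N = 1], can be on the left or on the right.  If there
are two children, then the left subtree ends at the last visit to height 1. *)
Lemma number_of_cuts N (D : rel nat) H : (forall r, D 0 r) -> admissible N.+1 D H ->
  count (fun i => cut i (N - i) H) (iota 0 N.+1) = 2 ^ (H N == 1).
Proof.
move=> D0 adm; have [H0 Hn st dom] := adm.
have pos t : 0 < t <= N.+1 -> 0 < H t by exact: admissible_gt0 adm.
have cardP s : uniq s -> (forall i, (i \in s) = (i <= N) && cut i (N - i) H) ->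
    count (fun i => cut i (N - i) H) (iota 0 N.+1) = size s.
  move=> us sE; rewrite -size_filter; apply/perm_size/uniq_perm => // [|i].
    exact: filter_uniq (iota_uniq _ _).
  by rewrite mem_filter mem_iota sE ltnS andbC.
have cutE i : i <= N ->
    reflect [/\ H i = (0 < i), forall t, i < t <= N -> (0 < i) < H t
              & H N = (0 < i) + (i < N)] (cut i (N - i) H).
  move=> iN; apply: (iffP (cutP _ _ _)); rewrite subnKC // subn_gt0;
    move=> [c1 c2 c3]; split=> // t tN.
    by have := c2 (t - i); rewrite subnKC; [apply; lia | lia].
  by apply: c2; lia.
have [N0|N0] := posnP N.
  subst N; rewrite (@cardP [:: 0]) ?H0 // => i.
  rewrite inE leqn0; case: eqP => //= ->; apply/esym/(cutE 0) => //.
  by split=> // t; lia.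
have := st N (leqnn _); rewrite Hn; have := pos N; rewrite N0 leqnSn => /(_ isT) HN HN'.
have {HN HN'} [HN|HN] : H N = 1 \/ H N = 2 by lia.
  rewrite HN (@cardP [:: 0; N]) //=; first by rewrite inE andbT; lia.
  move=> i; rewrite !inE; have [iN|] := leqP i N; last by lia.
  rewrite andTb; apply/idP/(cutE i iN) => [/orP[]/eqP ->|[_ _]].
  - by rewrite H0 HN; split=> // [t tN|]; [apply: pos; lia | lia].
  - by rewrite HN N0 ltnn; split=> // t; lia.
  by rewrite HN; lia.
rewrite HN; have H1 : H 1 = 1.
  by have := st 0; have := pos 1; rewrite H0; lia.
have ex : exists i, (i <= N) && (H i == 1) by exists 1; rewrite H1 eqxx andbT.
have bd i : (i <= N) && (H i == 1) -> i <= N by case/andP.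
case: (ex_maxnP ex bd) => i /andP[iN /eqP Hi] imax.
have i0 : 0 < i by case: (posnP i) Hi => // ->; rewrite H0.
rewrite (@cardP [:: i]) // => j; rewrite inE.
apply/eqP/andP => [->|[jN /(cutE j jN)[c1 c2 c3]]].
  split=> //; apply/(cutE i iN); rewrite Hi i0 HN; split=> // [t tN|].
    by have := imax t; have := pos t; case: (H t) => [|[|k]] //=; lia.
  have -> // : i < N.
  by rewrite ltn_neqAle iN andbT; apply: contra_eq_neq Hi => ->; rewrite HN.
have j0 : 0 < j by move: c3; rewrite HN; lia.
have := imax j; rewrite jN c1 j0 => /(_ isT) ji.
apply/eqP; rewrite eqn_leq ji leqNgt; apply/negP => ij.
by have := c2 i; rewrite ij iN j0 Hi => /(_ isT).
Qed.

(** * Preimages as decreasing binary trees *)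

(** In a postorder reading the entries [q] before the root are those of the left
subtree followed by those of the right one, with any place of division. *)
Definition split_folds (A : Type) (op : A -> A -> A) (F : seq nat -> seq A)
    (q : seq nat) : seq A :=
  [seq op c.1 c.2 | i <- iota 0 (size q).+1,
     c <- [seq (a, b) | a <- F (take i q), b <- F (drop i q)]].

(** The list of the values of the fold of [op] and [e] over all decreasing binary
trees with postorder reading [p], one value for each tree.  Different choices of
[op] list the preimages and their height paths in the same order, so that
the two lists have the same length.  The fuel [n] bounds the depth. *)
Fixpoint tree_folds_rec (A : Type) (op : nat -> A -> A -> A) (e : A)
    (n : nat) (p : seq nat) : seq A :=
  if n is n'.+1 then
    if p is x :: p' then
      let m := last x p' in
      let q := belast x p' in
      if all (fun y => y < m) q then split_folds (op m) (tree_folds_rec op e n') q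
      else [::]
    else [:: e]
  else [:: e].

Definition tree_folds (A : Type) (op : nat -> A -> A -> A) (e : A) (p : seq nat) :=
  tree_folds_rec op e (size p) p.

Lemma size_take_le (T : Type) i (s : seq T) : size (take i s) <= size s.
Proof. by rewrite size_take; case: ltnP => // /ltnW. Qed.

Lemma size_drop_le (T : Type) i (s : seq T) : size (drop i s) <= size s.
Proof. by rewrite size_drop leq_subr. Qed.

Lemma eq_split_folds A (op : A -> A -> A) F G q :
  (forall p, size p <= size q -> F p = G p) ->
  split_folds op F q = split_folds op G q.
Proof.
move=> FG; congr flatten; apply: eq_map => i.
by rewrite !FG ?size_take_le ?size_drop_le.
Qed.

Lemma tree_folds_rec_fuel A (op : nat -> A -> A -> A) e n p : size p <= n ->
  tree_folds_rec op e n p = tree_folds op e p.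
Proof.
suff H k : forall n p, size p <= k -> size p <= n ->
    tree_folds_rec op e n p = tree_folds_rec op e k p by move=> pn; exact: H.
elim: k => [|k IH] [|{}n] [|x {}p] //= pk pn.
case: ifP => // _; apply: eq_split_folds => q; rewrite size_belast => qp.
by apply: IH; apply: leq_trans qp _.
Qed.

Lemma tree_folds_rcons A (op : nat -> A -> A -> A) e q m :
  tree_folds op e (rcons q m) =
  if all (fun y => y < m) q then split_folds (op m) (tree_folds op e) q else [::].
Proof.
have [x [q' E]] : exists x q', rcons q m = x :: q'.
  by case: q => [|x q']; [exists m, [::] | exists x, (rcons q' m)].
have Em : m = last x q' by rewrite -(last_rcons x q m) E.
have Eq : q = belast x q'.
  by apply: (@rcons_injl _ m); rewrite [in RHS]Em -lastI.
rewrite /tree_folds E /= -Em -Eq; case: ifP => // _.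
apply: eq_split_folds => p pq; apply: tree_folds_rec_fuel.
by rewrite -(size_belast x q') -Eq.
Qed.

Lemma tree_folds_ind (P : seq nat -> Prop) : P [::] ->
  (forall q m, (forall p, size p <= size q -> P p) -> P (rcons q m)) ->
  forall p, P p.
Proof.
move=> P0 Pr p; have [n] := ubnP (size p); elim: n p => // n IH p.
case/lastP: p => [|q m] //; rewrite size_rcons ltnS => qn.
by apply: Pr => p pq; apply: IH; apply: leq_ltn_trans pq qn.
Qed.

Lemma size_tree_folds A B (op : nat -> A -> A -> A) e (op' : nat -> B -> B -> B) e' p :
  size (tree_folds op e p) = size (tree_folds op' e' p).
Proof.
elim/tree_folds_ind: p => // q m IH; rewrite !tree_folds_rcons; case: ifP => // _.
rewrite !size_allpairs_dep; congr sumn; apply: eq_map => i.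
by rewrite !size_allpairs; congr (_ * _); apply: IH; rewrite ?size_take_le ?size_drop_le.
Qed.

(** The in-order reading of a tree from those of its subtrees. *)
Definition insert_root (m : nat) (L R : seq nat) : seq nat := L ++ m :: R.

Definition preimage_list (p : seq nat) : seq (seq nat) :=
  tree_folds insert_root [::] p.

Lemma split_largest (w : seq nat) : uniq w -> w != [::] ->
  exists L m R, w = L ++ m :: R /\ all (fun x => x < m) (L ++ R).
Proof.
move=> uw w0; have mw := mem_largest w0.
have lew x : x \in w -> x <= largest w.
  elim: w {uw w0 mw} => // y w IH; rewrite inE /largest /= -/(largest w).
  by case/orP => [/eqP ->|/IH xw]; rewrite leq_max ?leqnn // xw orbT.
move: (largest w) mw lew => m mw lew.
case/splitPr: mw uw lew => L R uw lew; exists L, m, R; split=> //.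
apply/allP => x; rewrite mem_cat => xLR.
rewrite ltn_neqAle lew ?mem_cat ?inE; last by case/orP: xLR => ->; rewrite ?orbT.
rewrite andbT; apply: contraTneq uw => xm.
by rewrite -cat1s uniq_catCA cat1s cons_uniq mem_cat -xm xLR.
Qed.

Lemma perm_stack_sort (w : seq nat) : uniq w -> perm_eq (stack_sort w) w.
Proof.
have [n] := ubnP (size w); elim: n w => // n IH w wn uw.
have [->//|w0] := eqVneq w [::].
have [L [m [R [E lt]]]] := split_largest uw w0.
rewrite {}E in uw wn *; rewrite stack_sort_split //.
move: wn uw; rewrite size_cat /= addnS ltnS => wn.
rewrite cat_uniq /= => /and3P[uL _ /andP[_ uR]].
apply: perm_cat; first by apply: IH => //; apply: leq_ltn_trans wn; exact: leq_addr.
rewrite cats1 perm_rcons perm_cons; apply: IH => //.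
by apply: leq_ltn_trans wn; exact: leq_addl.
Qed.

Lemma mem_split_folds (A : eqType) (op : A -> A -> A) F q c :
  reflect (exists i a b, [/\ i <= size q, a \in F (take i q), b \in F (drop i q)
                           & c = op a b])
          (c \in split_folds op F q).
Proof.
apply: (iffP allpairsPdep) => [[i [[a b] [iq]]]|[i [a [b [iq aF bF ->]]]]].
  rewrite mem_iota ltnS in iq => /allpairsP[[a' b'] /= [aF bF [-> ->]]] ->.
  by exists i, a', b'.
by exists i, (a, b); rewrite mem_iota ltnS; split=> //; apply/allpairsP; exists (a, b).
Qed.

Lemma mem_preimage_list (p w : seq nat) : uniq p ->
  (w \in preimage_list p) = uniq w && (stack_sort w == p).
Proof.
elim/tree_folds_ind: p w => [|q m IH] w.
  rewrite inE => _; apply/eqP/andP => [->//|[uw /eqP sw]].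
  by apply/eqP; rewrite -size_eq0 -(perm_size (perm_stack_sort uw)) sw.
rewrite rcons_uniq => /andP[mq uq]; rewrite /preimage_list tree_folds_rcons.
apply/idP/andP.
  case: ifP => // qm /mem_split_folds[i [L [R [iq]]]].
  rewrite -!/(preimage_list _) !IH ?size_take_le ?size_drop_le ?take_uniq ?drop_uniq //.
  move=> /andP[uL /eqP sL] /andP[uR /eqP sR] ->; rewrite /insert_root.
  have pq : perm_eq (L ++ R) q.
    rewrite -(cat_take_drop i q) -sL -sR perm_sym.
    by rewrite perm_cat ?perm_stack_sort.
  split; last by rewrite stack_sort_split ?(perm_all _ pq) // sL sR catA cat_take_drop cats1.
  by rewrite -cat1s uniq_catCA cat1s cons_uniq (perm_mem pq) mq (perm_uniq pq).
move=> [uw /eqP sw]; have w0 : w != [::].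
  by apply/eqP => w0; move: sw; rewrite w0 => /(congr1 size); rewrite size_rcons.
have [L [M [R [E lt]]]] := split_largest uw w0.
move: sw uw; rewrite E stack_sort_split // catA cats1 => /rcons_inj[sw EM].
rewrite -cat1s uniq_catCA cat1s cons_uniq cat_uniq => /and4P[_ uL _ uR].
have pq : perm_eq (L ++ R) q by rewrite -sw perm_sym perm_cat ?perm_stack_sort.
rewrite -EM -(perm_all _ pq) lt.
apply/mem_split_folds; exists (size (stack_sort L)), L, R.
rewrite -!/(preimage_list _) -sw size_cat leq_addr take_size_cat // drop_size_cat //.
have usort X : uniq X -> uniq (stack_sort X) by move=> uX; rewrite (perm_uniq (perm_stack_sort uX)).
rewrite !IH ?usort ?uL ?uR ?eqxx //;
  by rewrite -sw size_cat ?leq_addr ?leq_addl.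
Qed.

Lemma uniq_split_folds (A : eqType) (op : A -> A -> A) F q :
  (forall i, uniq (F (take i q)) /\ uniq (F (drop i q))) ->
  (forall i j a b a' b', a \in F (take i q) -> b \in F (drop i q) ->
     a' \in F (take j q) -> b' \in F (drop j q) -> i <= size q -> j <= size q ->
     op a b = op a' b' -> [/\ i = j, a = a' & b = b']) ->
  uniq (split_folds op F q).
Proof.
move=> uF inj; apply: allpairs_uniq_dep; first exact: iota_uniq.
  move=> i _; have [ua ub] := uF i.
  by apply: allpairs_uniq => // -[? ?] [? ?] _ _ /= [-> ->].
move=> x y /allpairsPdep[i [c [iq cF ->]]] /allpairsPdep[j [d [jq dF ->]]] /=.
move: iq jq cF dF; rewrite !mem_iota !ltnS /= => iq jq.
move=> /allpairsP[[a b] /= [aF bF ->]] /allpairsP[[a' b'] /= [aF' bF' ->]] e.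
by have [-> -> ->] := inj _ _ _ _ _ _ aF bF aF' bF' iq jq e.
Qed.

Lemma uniq_preimage_list (p : seq nat) : uniq p -> uniq (preimage_list p).
Proof.
elim/tree_folds_ind: p => // q m IH.
rewrite rcons_uniq => /andP[mq uq]; rewrite /preimage_list tree_folds_rcons.
case: ifP => // qm; apply: uniq_split_folds => [i|].
  by split; apply: IH; rewrite ?size_take_le ?size_drop_le ?take_uniq ?drop_uniq.
move=> i j L R L' R'; rewrite -!/(preimage_list _) !mem_preimage_list ?take_uniq ?drop_uniq //.
move=> /andP[uL /eqP sL] /andP[uR /eqP sR] /andP[uL' /eqP sL'] /andP[uR' /eqP sR'] iq jq.
have szL k (X : seq nat) : uniq X -> stack_sort X = take k q -> k <= size q -> size X = k.
  by move=> uX sX kq; rewrite -(perm_size (perm_stack_sort uX)) sX size_takel.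
have notL k (X : seq nat) : uniq X -> stack_sort X = take k q -> m \notin X.
  move=> uX sX; rewrite -(perm_mem (perm_stack_sort uX)) sX.
  by apply: contra mq; exact: mem_take.
move=> e; have ij : i = j.
  have := congr1 (index m) e; rewrite !index_cat (negbTE (notL i _ uL sL)).
  by rewrite (negbTE (notL j _ uL' sL')) /= eqxx !addn0 (szL i) // (szL j).
split=> //; move/eqP: e; rewrite eqseq_cat ?(szL i L) ?(szL j L') //.
  by case/andP=> /eqP.
by case/andP=> _ /eqP[].
Qed.

(** * Height paths of decreasing binary trees *)

(** Positions are counted from 1, and position 0 acts as an infinite entry. *)
Definition dominates (p : seq nat) : rel nat :=
  fun i j => (i == 0) || (nth 0 (0 :: p) j < nth 0 (0 :: p) i).

(** The right subtree is read with the left one, when there is one, already on the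
stack. *)
Definition join_heights (_ : nat) (a b : seq nat) : seq nat :=
  rcons (a ++ map (addn (a != [::])) b) 1.

Definition height_list (p : seq nat) : seq (seq nat) := tree_folds join_heights [::] p.

Definition valid_path (p h : seq nat) : Prop :=
  size h = size p /\ admissible (size p) (dominates p) (height h).

Lemma dominates_take p q i j : i <= size p -> j <= size p ->
  dominates (p ++ q) i j = dominates p i j.
Proof. by move=> ip jp; rewrite /dominates -!cat_cons !nth_cat /= !ltnS ip jp. Qed.

Lemma dominates_drop p q r i j : i < j <= size q ->
  after (size p) (dominates (p ++ q ++ r)) i j = dominates q i j.
Proof.
move=> /andP[ij jq]; rewrite /after /dominates; case: i ij => [|i] //= ij.
case: j ij jq => // j ij jq.
rewrite !addnS /= !nth_cat !ltnNge !leq_addr /= !addKn.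
by rewrite -!ltnNge jq (ltn_trans _ jq).
Qed.

Lemma height_rcons h x t : t <= size h -> height (rcons h x) t = height h t.
Proof. by case: t => // t th; rewrite /height /= nth_rcons th. Qed.

Lemma height_cat_l a b t : t <= size a -> height (a ++ b) t = height a t.
Proof. by case: t => // t th; rewrite /height /= nth_cat th. Qed.

Lemma height_cat_r a b t : 0 < t -> height (a ++ b) (size a + t) = height b t.
Proof.
by case: t => // t _; rewrite /height addnS /= nth_cat ltnNge leq_addr /= addKn.
Qed.

Lemma neq_nil_size (s : seq nat) : (s != [::]) = (0 < size s).
Proof. by case: s. Qed.

Lemma join_heights_r m a b t : 0 < t <= size b ->
  height (join_heights m a b) (size a + t) = height b t + (0 < size a).
Proof.
move=> /andP[t0 tb]; rewrite /join_heights height_rcons ?size_cat ?size_map ?leq_add2l //.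
rewrite height_cat_r // neq_nil_size /height; case: t t0 tb => // t _ tb /=.
by rewrite (nth_map 0) // addnC.
Qed.

Lemma join_valid p q m a b : all (fun y => y < m) (p ++ q) ->
  valid_path p a -> valid_path q b ->
  valid_path (rcons (p ++ q) m) (join_heights m a b) /\
  cut (size p) (size q) (height (join_heights m a b)).
Proof.
move=> lt [sa adma] [sb admb]; rewrite /valid_path size_rcons size_cat.
have szj : size (join_heights m a b) = (size p + size q).+1.
  by rewrite size_rcons size_cat size_map sa sb.
rewrite szj.
have [adm c] : admissible (size p + size q).+1 (dominates (rcons (p ++ q) m))
    (height (join_heights m a b)) /\ cut (size p) (size q) (height (join_heights m a b)).
  apply: (@admissible_join _ _ _ _ (height b)) => //.
  - move=> i /andP[i0 ipq]; rewrite /dominates -!rcons_cons !nth_rcons /= size_cat.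
    rewrite ltnn eqxx ltnS ipq gtn_eqF //= -leqNgt ltnW //.
    case: i i0 ipq => // i _ ipq /=; apply: (allP lt); apply: mem_nth.
    by rewrite size_cat.
  - apply: (@eq_admissible_rel _ (dominates p)).
      by move=> i j ij; rewrite -cats1 -catA dominates_take; lia.
    apply: eq_admissible adma => t tp.
    by rewrite height_rcons ?height_cat_l ?size_cat ?sa //; lia.
  - apply: (@eq_admissible_rel _ (dominates q)) => // i j ij.
    by rewrite -cats1 -catA dominates_drop.
  - move=> t tq; have [->|t0] := posnP t.
      rewrite addn0 height_rcons ?height_cat_l ?size_cat ?sa ?leq_addr //.
      by case: adma => _ -> _ _; rewrite /height.
    by rewrite -sa join_heights_r ?t0 ?sb.
  by rewrite /height /= /join_heights nth_rcons size_cat size_map sa sb ltnn eqxx.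
by split.
Qed.

Lemma height_list_valid p h : h \in height_list p -> valid_path p h.
Proof.
elim/tree_folds_ind: p h => [|q m IH] h.
  by rewrite inE => /eqP ->; split=> //; split=> // ? ? /=; lia.
rewrite /height_list tree_folds_rcons; case: ifP => // qm.
case/mem_split_folds => i [a [b [iq al bl ->]]].
have lt : all (fun y => y < m) (take i q ++ drop i q) by rewrite cat_take_drop.
have va : valid_path (take i q) a by apply: IH al; exact: size_take_le.
have vb : valid_path (drop i q) b by apply: IH bl; exact: size_drop_le.
by have [] := join_valid lt va vb; rewrite cat_take_drop.
Qed.

(** The last entry of [q] that is at least [m] would dominate all later entries,
so the stack could not come down to height 1. *)
Lemma valid_path_max q m h : uniq (rcons q m) -> valid_path (rcons q m) h ->
  all (fun y => y < m) q.
Proof.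
rewrite rcons_uniq => /andP[mq uq] [_]; rewrite size_rcons => adm.
have D0 r : dominates (rcons q m) 0 r by [].
have [_ Hn _ dom] := adm.
apply/negP => /negP; rewrite -has_predC => hq.
have ex : exists i, (i < size q) && (m <= nth 0 q i).
  by case/(has_nthP 0): hq => i iq /=; rewrite -leqNgt => h'; exists i; rewrite iq.
have bd i : (i < size q) && (m <= nth 0 q i) -> i <= size q by case/andP => /ltnW.
case: (ex_maxnP ex bd) => i /andP[iq mi] imax.
have mlt : m < nth 0 q i.
  by rewrite ltn_neqAle mi andbT; apply: contraNneq mq => ->; exact: mem_nth.
have : height h i.+1 < height h (size q).+1.
  apply: dom; first by rewrite ltnS iq leqnn.
  move=> [|r] // /andP[ir rq]; rewrite /dominates /= !nth_rcons iq.
  case: (ltngtP r (size q)) rq => [rq' _|qr rq|//]; last lia.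
  apply: leq_trans mlt; rewrite ltnS leqNgt; apply/negP => mr.
  by have := imax r; rewrite rq' (ltnW mr) => /(_ isT); rewrite leqNgt (ir : i < r).
rewrite Hn /= ltnS leqn0 => /eqP h0; have := @admissible_gt0 _ _ _ i.+1 D0 adm.
by rewrite h0 !ltnS (ltnW iq) => /(_ isT).
Qed.

Lemma count_pairs (T U : Type) (P : pred T) (Q : pred U) s t :
  count (fun c => P c.1 && Q c.2) [seq (a, b) | a <- s, b <- t] = count P s * count Q t.
Proof.
elim: s => //= a s IH; rewrite count_cat IH mulnDl count_map; congr (_ + _).
rewrite (@eq_count _ _ (fun b => P a && Q b)) //.
by case: (P a); rewrite ?mul1n ?mul0n ?count_pred0.
Qed.

Lemma count_split_folds (A : eqType) (op : A -> A -> A) F q c :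
  count_mem c (split_folds op F q) =
  \sum_(i <- iota 0 (size q).+1)
    count (fun d => op d.1 d.2 == c) [seq (a, b) | a <- F (take i q), b <- F (drop i q)].
Proof.
rewrite /split_folds; elim: (iota _ _) => [|i s IH]; first by rewrite big_nil.
by rewrite big_cons -IH /= count_cat count_map.
Qed.

Lemma join_heights_eq m a b h i : size a = i -> size b = size h - i -> i <= size h ->
  (forall t, 0 < t <= size h - i -> (0 < i) < height h (i + t)) ->
  (join_heights m a b == rcons h 1) =
  (a == take i h) && (b == [seq x - (0 < i) | x <- drop i h]).
Proof.
move=> sa sb ih c2.
rewrite /join_heights eqseq_rcons andbT -{1}(cat_take_drop i h).
rewrite eqseq_cat ?size_takel ?sa //; congr (_ && _).
rewrite neq_nil_size sa; apply/eqP/eqP => [<-|->].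
  by rewrite -map_comp -[LHS]map_id; apply: eq_map => x /=; rewrite addKn.
rewrite -map_comp -[RHS]map_id; apply/eq_in_map => x /(nthP 0)[t].
rewrite size_drop nth_drop => th <-; rewrite /= subnKC //.
by apply: ltnW; have := c2 t.+1; rewrite addnS; apply.
Qed.

(** A tree with path [rcons h 1] is a place of division of [q] that is a cut of
the path, together with trees for the two parts.  The weights of the parts multiply
to the weight of the whole up to the last step, and when this step is level
there are two cuts. *)
Lemma count_height_list p h : uniq p -> valid_path p h ->
  count_mem h (height_list p) = weight h.
Proof.
elim/tree_folds_ind: p h => [|q m IH] h.
  by case: h => [|x h] // _ [].
move=> up vh; have qm := valid_path_max up vh.
move: vh => [sh]; rewrite size_rcons in sh *.
case/lastP: h sh => // h x; rewrite size_rcons => -[sh] adm.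
have x1 : x = 1.
  by case: adm => _ + _ _; rewrite /height /= nth_rcons sh ltnn eqxx.
move: adm; rewrite {}x1 => adm.
rewrite /height_list tree_folds_rcons qm count_split_folds.
have D0 r : dominates (rcons q m) 0 r by [].
pose H := height (rcons h 1).
have uq : uniq q by move: up; rewrite rcons_uniq => /andP[].
have Hh t : t <= size q -> height h t = H t.
  by move=> tq; rewrite /H height_rcons ?sh.
have HN1 : H (size q).+1 = 1 by case: adm.
pose d := (H (size q) == 1).
(* [W] is the product of the weights of the two parts, the same for every cut. *)
pose W := 2 ^ (size (level_steps (rcons h 1)) - d).
rewrite (eq_big_seq (fun i => if cut i (size q - i) H then W else 0)).
  rewrite -big_mkcond big_const_seq iter_addn_0 (number_of_cuts D0 adm) -/d.
  rewrite /W /weight -expnD subnK // /d.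
  case: eqP => // H1; rewrite lt0n size_eq0; apply/eqP => lev0.
  have : size q \in level_steps (rcons h 1).
    by rewrite mem_levels size_rcons sh -/H HN1 H1 ltnSn eqxx.
  by rewrite lev0.
move=> i; rewrite mem_iota add0n ltnS => /andP[_ iq].
have st : size (take i q) = i by rewrite size_takel.
have sd : size (drop i q) = size q - i by rewrite size_drop.
have lt : all (fun y => y < m) (take i q ++ drop i q) by rewrite cat_take_drop.
case: ifP => ci; last first.
  apply/eqP; rewrite -leqn0 leqNgt -has_count; apply/hasP.
  move=> [_ /allpairsP[[a b] /= [al bl ->]] /= /eqP e].
  have [_] := join_valid lt (height_list_valid al) (height_list_valid bl).
  by rewrite st sd e ci.
have [c1 c2 _] := cutP _ _ _ ci.
pose a0 := take i h; pose b0 := [seq x - (0 < i) | x <- drop i h].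
have sa0 : size a0 = i by rewrite size_takel ?sh.
have sb0 : size b0 = size q - i by rewrite size_map size_drop sh.
have ha0 t : t <= i -> height a0 t = H t.
  move=> ti; rewrite -Hh; last exact: leq_trans ti iq.
  by rewrite -[in RHS](cat_take_drop i h) height_cat_l // -/a0 sa0.
have hb0 t : t <= size q - i -> height b0 t = second_part i H t.
  rewrite /second_part; case: t => [|t] tq; first by rewrite addn0 c1 subnn.
  rewrite -Hh; last by lia.
  by rewrite /height addnS /= (nth_map 0) ?nth_drop // size_drop sh.
have adm' : admissible (i + (size q - i)).+1 (dominates (rcons q m)) H by rewrite subnKC.
have [adma admb] := admissible_split adm' ci.
have qmE : rcons q m = take i q ++ drop i q ++ [:: m] by rewrite catA cat_take_drop cats1.
have va : valid_path (take i q) a0.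
  split; first by rewrite sa0 st.
  rewrite st; apply: (@eq_admissible_rel _ (dominates (rcons q m))).
    by move=> j k jk; rewrite qmE dominates_take ?st; lia.
  by apply: eq_admissible adma => t ti; rewrite ha0.
have vb : valid_path (drop i q) b0.
  split; first by rewrite sb0 sd.
  rewrite sd; apply: (@eq_admissible_rel _ (after i (dominates (rcons q m)))).
    by move=> j k jk; rewrite qmE -{1}st dominates_drop ?sd.
  by apply: eq_admissible admb => t ti; rewrite hb0.
rewrite (@eq_in_count _ _ (fun c => (c.1 == a0) && (c.2 == b0))); last first.
  move=> _ /allpairsP[[a b] /= [al bl ->]] /=.
  have [sa _] := height_list_valid al; have [sb _] := height_list_valid bl.
  apply: join_heights_eq; rewrite ?sa ?sb ?sh // => t tq.
  by rewrite Hh; [exact: c2 | lia].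
rewrite (count_pairs (pred1 a0) (pred1 b0)) -!/(height_list _).
rewrite !IH ?size_take_le ?size_drop_le ?take_uniq ?drop_uniq // -expnD.
congr (2 ^ _); rewrite /level_steps sa0 sb0 size_rcons sh -/H.
rewrite (eq_levels ha0) (eq_levels hb0) /d.
have := size_levels_cut ci; rewrite subnKC // => ->; last exact: HN1.
by rewrite -addnA addKn.
Qed.

(** * Fertility numbers *)

Lemma enumerates_height_list p : uniq p ->
  enumerates_paths (size p) (dominates p) (undup (height_list p)).
Proof.
move=> up; split; first exact: undup_uniq.
move=> h; rewrite mem_undup; split=> [|vh]; first exact: height_list_valid.
by rewrite -has_pred1 has_count (count_height_list up vh) expn_gt0.
Qed.

Lemma size_preimage_list p : uniq p ->
  size (preimage_list p) = \sum_(h <- undup (height_list p)) weight h.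
Proof.
move=> up; rewrite /preimage_list (size_tree_folds _ _ join_heights [::]).
rewrite -/(height_list p) -(perm_size (perm_count_undup (height_list p))).
rewrite size_flatten /shape sumnE big_map big_map.
apply: eq_big_seq => h; rewrite mem_undup size_nseq => hl.
exact: count_height_list up (height_list_valid hl).
Qed.

Lemma has_fertility_size p f : is_permutation p ->
  has_fertility p f <-> f = size (preimage_list p).
Proof.
move=> /andP[up pos].
have memP w : preimages p w <-> w \in preimage_list p.
  rewrite mem_preimage_list //; split=> [[/andP[-> _] ->]|/andP[uw /eqP sw]] //.
    by rewrite eqxx.
  by split=> //; rewrite /is_permutation uw -(perm_all _ (perm_stack_sort uw)) sw.
have card : (preimages p #= `I_(size (preimage_list p)))%card.
  have -> : preimages p = ((nth [::] (preimage_list p)) @` `I_(size (preimage_list p)))%classic.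
    apply/seteqP; split=> [w /memP /(nthP [::])[i il <-]|w [i /= il <-]].
      by exists i.
    by apply/memP; exact: mem_nth.
  apply: inj_card_eq => i j; rewrite !inE => il jl /eqP.
  by rewrite nth_uniq ?uniq_preimage_list // => /eqP.
split=> [hf|->] //; apply/card_eq_II.
exact: card_eq_trans (card_esym hf) card.
Qed.

Theorem theorem3p4 :
  fertility_number 27 /\
  27 = 3 %[mod 4] /\
  (forall f : nat, fertility_number f -> f = 3 %[mod 4] -> 27 <= f).
Proof.
split; last split=> //.
  by exists [:: 3; 2; 1; 4; 5; 6; 7]; split=> //; apply/has_fertility_size; vm_compute.
move=> f [p [pp /(has_fertility_size _ pp) ->]]; have /andP[up _] := pp.
rewrite size_preimage_list //; apply: weight_sum_ge27.
  by move=> r; exact: (isT : dominates p 0 r).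
exact: enumerates_height_list.
Qed.
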